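(* Let $p\ge2$. Then for all real-valued $u\in C_c(\mathbb{N}_0)$ with $u(0)=0$, $$\sum_{n=1}^{\infty}|u(n)-u(n-1)|^p-\left(\frac{p-1}{p}\right)^p\sum_{n=1}^{\infty}\frac{|u(n)|^p}{n^p}\ \ge\ c_1(p)\left(\frac{p-1}{p}\right)^p\inf_{c\in\mathbb{R}}\sum_{n=3}^{\infty}\frac{\left|u(n)-c\,n^{\frac{p-1}{p}}\right|^p}{n^p\log^p(n)}.$$
   Context: $\mathbb{N}_0=\{0,1,2,\dots\}$, and $C_c(\mathbb{N}_0)$ denotes the set of finitely supported sequences on $\mathbb{N}_0$. $\log^p(n)$ means $(\log n)^p$ with the natural logarithm. For $p\ge2$, $$c_1(p):=\inf_{(s,t)\in\mathbb{R}^2\setminus\{(0,0)\}}\frac{\bigl[t^2+s^2+2s+1\bigr]^{p/2}-1-ps}{\bigl[t^2+s^2\bigr]^{p/2}}\in(0,1].$$ *)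

(* Defs.v *)
From HB Require Import structures.
From mathcomp Require Import all_boot all_order all_algebra.
From mathcomp Require Import all_classical all_reals all_analysis.
From mathcomp Require Import ring lra.

Set Implicit Arguments.
Unset Strict Implicit.
Unset Printing Implicit Defensive.

Import Order.TTheory GRing.Theory Num.Theory.
Import numFieldNormedType.Exports.

Local Open Scope classical_set_scope.
Local Open Scope ring_scope.

Definition finitely_supported (R : realType) (u : nat -> R) : Prop :=
  finite_set [set n | u n != 0].

Definition c1_quotient (R : realType) (p : R) (s t : R) : R :=
  ((t ^+ 2 + s ^+ 2 + 2 * s + 1) `^ (p / 2) - 1 - p * s)
    / (t ^+ 2 + s ^+ 2) `^ (p / 2).

Definition c1_values (R : realType) (p : R) : set R :=
  [set c1_quotient p st.1 st.2 | st in [set st : R * R | st <> (0, 0)]].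

Definition c1 (R : realType) (p : R) : R := inf (c1_values p).

(* The real infimum defining [c1 p] is genuine, not the default value 0. *)
Lemma has_inf_c1_values (R : realType) (p : R) :
  2 <= p -> has_inf (c1_values p).
Proof.
move=> p2; split.
  exists (c1_quotient p 1 0); exists (1, 0) => //=.
  by case=> /eqP; rewrite oner_eq0.
exists 0 => _ [[s t] /= _ <-]; apply: divr_ge0; last exact: powR_ge0.
have p0 : 0 < p by lra.
have sq : `|1 + s| `^ p = (`|1 + s| ^+ 2) `^ (p / 2).
  by rewrite -powR_mulrn// -powRrM; congr (_ `^ _); field.
have le1 : `|1 + s| `^ p <= (t ^+ 2 + s ^+ 2 + 2 * s + 1) `^ (p / 2).
  rewrite sq; apply: ge0_ler_powR; rewrite ?nnegrE.
  - by rewrite divr_ge0// ltW.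
  - exact: exprn_ge0.
  - by have := sqr_ge0 t; have := sqr_ge0 (1 + s); nra.
  - by rewrite real_normK ?num_real//; have := sqr_ge0 t; nra.
have q0 : 0 < p / (p - 1) by rewrite divr_gt0//; lra.
have := @conjugate_powR R `|1 + s| 1 p (p / (p - 1)) (normr_ge0 _) ler01 p0 q0.
rewrite invf_div powR1 mulr1 mul1r => /(_ _)/wrap[].
  by field; lra.
rewrite -(ler_pM2l p0) mulrDr !(mulrCA p) divff ?mulr1; last lra.
by have := ler_norm (1 + s); nra.
Qed.

(* Main.v *)
Require Import Defs.
From mathcomp Require Import all_boot all_order all_algebra.
From mathcomp Require Import all_classical all_reals all_analysis.
From mathcomp Require Import ring lra.

(** Put s = (p - 1) / p, h(n) = n^s and u = h v.  The sequence h is a positive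
    supersolution of the discrete p-Laplace equation whose potential is the
    Hardy weight s^p / n^p ([ground_state_supersolution]).  For a supersolution
    Picone's inequality bounds the energy of u below by its potential term, and
    keeping the convexity remainder measured by [c1 p] in each of its
    increments ([picone_remainder]) gives, after summation by parts
    ([ground_state_ineq]),

      sum |u(n) - u(n-1)|^p - s^p sum |u(n)|^p / n^p
        >= c1(p) sum (n-1)^(p-1) |v(n) - v(n-1)|^p.

    Since (n-1)^(p-1) is the power 1 - p of 1/(n-1), the right-hand side is the
    energy in a second Hardy inequality, the one for the weights 1/(n-1), n >= 3
    ([weighted_hardy]).  Their partial sums
    1/2 + ... + 1/(n-1) are at most log n ([sum_inv_le_ln]), which is how the
    logarithm arises.  That inequality needs a function vanishing at its
    starting point n = 2; it is applied to v - v(2), so that the infimum over c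
    is bounded by its value at c = v(2) = u(2) / 2^s.

    The supersolution property is the inequality
    A^(p-1) - B^(p-1) >= (p-1) x / p, at x = 1/n, for the difference quotients
    A = (1 - (1-x)^s) / (s x) and B = ((1+x)^s - 1) / (s x).  It follows from
    A - B >= x / p, because B <= 1 <= A, A B >= 1 and p - 1 >= 1 force
    A^(p-1) - B^(p-1) >= (p-1) (A - B) ([powR_sub_ge]).

    All of this is proved for partial sums; since u has finite support, they
    coincide with the series on the larger side as soon as they are long
    enough. *)

Import Order.TTheory GRing.Theory Num.Theory.
Import numFieldNormedType.Exports.

Local Open Scope classical_set_scope.
Local Open Scope ring_scope.

(** * Monotonicity arguments for real powers *)

Lemma ge0_is_derive_le (R : realType) (f df : R -> R) (a b : R) : a <= b ->
  (forall x, a <= x <= b -> is_derive x 1 f (df x)) ->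
  (forall x, a <= x <= b -> 0 <= df x) -> f a <= f b.
Proof.
move=> ab fdf df0.
have [x xab fE] : exists2 c, c \in `[a, b]%R & f b - f a = df c * (b - a).
  apply: MVT_segment => // [x|].
    by rewrite in_itv/= => /andP[ax xb]; apply: fdf; rewrite !ltW.
  apply: derivable_within_continuous => x; rewrite in_itv/= => xab.
  by have [] := fdf x xab.
by rewrite -subr_ge0 fE mulr_ge0 ?subr_ge0// df0// -in_itv.
Qed.

Lemma is_derive_powR_affine (R : realType) (k e x : R) : 0 < 1 + k * x ->
  is_derive x 1 (fun y => (1 + k * y) `^ e) (k * (e * (1 + k * x) `^ (e - 1))).
Proof.
move=> kx0.
have dg : is_derive x (1 : R) (fun y : R => 1 + k * y) k.
  by apply: is_derive_eq; rewrite add0r mul1r; exact: mulr1.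
have := @is_derive1_comp _ (fun y : R => y `^ e) _ x _ _ (is_derive1_powR e kx0) dg.
by rewrite mulrC.
Qed.

Lemma powRVr (R : realType) (e x : R) : 0 <= x -> x^-1 `^ e = (x `^ e)^-1.
Proof. by move=> x0; rewrite -powR_inv1// -powRrM mulN1r powRN. Qed.

(** The product of the two terms is (1 - y^2)^e >= 1, so their sum is at least
    2 by the inequality of arithmetic and geometric means. *)
Lemma powR_sum_ge2 (R : realType) (e y : R) : e <= 0 -> 0 <= y < 1 ->
  2 <= (1 + y) `^ e + (1 - y) `^ e.
Proof.
move=> e0 /andP[y0 y1].
have u0 : 0 < 1 + y by lra.
have v0 : 0 < 1 - y by lra.
have uv : 1 <= (1 + y) `^ e * (1 - y) `^ e.
  rewrite -powRM; [|lra|lra]; rewrite -[X in X <= _](powRr0 ((1 + y) * (1 - y))).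
  by apply: ger_powR => //; rewrite mulr_gt0//=; have := sqr_ge0 y; nra.
have := powR_gt0 e u0; have := powR_gt0 e v0; move: uv.
move: (_ `^ _) (_ `^ _) => a b ab1 b0 a0.
by have := sqr_ge0 (a - b); nra.
Qed.

(** The two sides agree at y = 0, and [powR_sum_ge2], for the exponent e - 1,
    compares their derivatives.  It is used for e = s in [powR_midpoint] and,
    with a negative exponent, for e = s - 1 in [powR_second_diff_lt1]. *)
Lemma powR_central_diff (R : realType) (e y : R) : e != 0 -> e <= 1 ->
  0 <= y < 1 -> 2 * y <= ((1 + y) `^ e - (1 - y) `^ e) / e.
Proof.
move=> e0 e1 /andP[y0 y1].
pose f (t : R) := e^-1 * ((1 + 1 * t) `^ e - (1 + (- 1) * t) `^ e) - 2 * t.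
pose df (t : R) := e^-1 * (1 * (e * (1 + 1 * t) `^ (e - 1))
   - (- 1) * (e * (1 + (- 1) * t) `^ (e - 1))) - 2.
suff : f 0 <= f y.
  by rewrite /f !mulr0 addr0 subrr mulr0 subrr !mul1r mulN1r mulrC; lra.
apply: (ge0_is_derive_le _ f df) => // x /andP[x0 xy].
  have d1 : is_derive x 1 _ _ := is_derive_powR_affine R 1 e x ltac:(lra).
  have d2 : is_derive x 1 _ _ := is_derive_powR_affine R (-1) e x ltac:(lra).
  by apply: is_derive_eq; rewrite /df; congr (_ - _); exact: mulr1.
have : 2 <= (1 + x) `^ (e - 1) + (1 - x) `^ (e - 1).
  by apply: powR_sum_ge2; lra.
rewrite /df !mul1r !mulN1r opprK -mulrDr mulrA mulVf// mul1r; lra.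
Qed.

(** The derivative of the right-hand side is s times a central difference of
    the power s - 1, which [powR_central_diff] bounds.  The point x = 1, where
    that derivative is infinite, is left to [powR_second_diff]. *)
Lemma powR_second_diff_lt1 (R : realType) (s x : R) : 0 < s < 1 -> 0 <= x < 1 ->
  s * (1 - s) * x ^+ 2 <= 2 - (1 - x) `^ s - (1 + x) `^ s.
Proof.
move=> /andP[s0 s1] /andP[x0 x1].
pose f (t : R) := 2 - (1 + (- 1) * t) `^ s - (1 + 1 * t) `^ s
   - s * (1 - s) * t ^+ 2.
pose df (t : R) := - ((- 1) * (s * (1 + (- 1) * t) `^ (s - 1)))
   - (1 * (s * (1 + 1 * t) `^ (s - 1))) - s * (1 - s) * (2 * t).
suff : f 0 <= f x.
  by rewrite /f !mulr0 addr0 expr0n/= mulr0 powR1 !mul1r mulN1r; lra.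
apply: (ge0_is_derive_le _ f df) => // y /andP[y0 yx].
  have d1 : is_derive y 1 _ _ := is_derive_powR_affine R 1 s y ltac:(lra).
  have d2 : is_derive y 1 _ _ := is_derive_powR_affine R (-1) s y ltac:(lra).
  apply: is_derive_eq; rewrite /df add0r !mul1r; congr (_ - _ - _ * _).
  by rewrite mulr_natl mulr2n; congr (_ + _); exact: mulr1.
have : 2 * y <= ((1 + y) `^ (s - 1) - (1 - y) `^ (s - 1)) / (s - 1).
  by apply: powR_central_diff; lra.
rewrite ler_ndivlMr; last lra.
rewrite /df !mul1r !mulN1r opprK; nra.
Qed.

(** With r = exp(d) this says that sinh(q d) >= q sinh(d).  The derivative in r
    of the difference is q (r^(q-1) - 1) (1 - r^(-q-1)) >= 0. *)
Lemma powR_sub_inv_ge (R : realType) (q r : R) : 1 <= q -> 1 <= r ->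
  q * (r - r^-1) <= r `^ q - r `^ (- q).
Proof.
move=> q1 r1.
pose f (t : R) := (1 + 1 * t) `^ q - (1 + 1 * t) `^ (- q)
   - q * (1 * t - (1 + 1 * t) `^ (- 1)).
pose df (t : R) := 1 * (q * (1 + 1 * t) `^ (q - 1))
   - 1 * ((- q) * (1 + 1 * t) `^ (- q - 1))
   - q * (1 - 1 * ((- 1) * (1 + 1 * t) `^ (- 1 - 1))).
suff : f 0 <= f (r - 1).
  rewrite /f !mulr0 addr0 !powR1 !mul1r subrr.
  have -> : 1 + (r - 1) = r by lra.
  by rewrite powR_inv1; lra.
apply: (ge0_is_derive_le _ f df) => [|x|x]; [lra| |] => /andP[x0 _].
  have d1 a : is_derive x 1 _ _ := is_derive_powR_affine R 1 a x ltac:(lra).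
  by apply: is_derive_eq; rewrite /df; congr (_ - _ * (_ - _)); exact: mulr1.
rewrite /df !mul1r.
set y := 1 + x.
have y1 : 1 <= y by rewrite /y; lra.
have yN0 : y != 0 by rewrite gt_eqF//; lra.
have a1 : 1 <= y `^ (q - 1).
  by rewrite -[X in X <= _](powRr0 y); apply: ler_powR => //; lra.
have b1 : y `^ (- q - 1) <= 1.
  by rewrite -[X in _ <= X](powRr0 y); apply: ler_powR => //; lra.
have -> : y `^ (- 1 - 1) = y `^ (q - 1) * y `^ (- q - 1).
  by rewrite -powRD ?yN0 ?implybT//; congr (_ `^ _); lra.
move: (y `^ (q - 1)) (y `^ (- q - 1)) a1 b1 => a b a1 b1.
have : 0 <= (a - 1) * (1 - b) by rewrite mulr_ge0; lra.
nra.
Qed.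

(** * Convexity inequalities and the Hardy weight *)

(** Young's inequality for the product of z and 1. *)
Lemma powR_bernoulli (R : realType) (p z : R) : 1 <= p -> 0 <= z ->
  1 + p * (z - 1) <= z `^ p.
Proof.
move=> p1 z0; have [->|pN1] := eqVneq p 1; first by rewrite powRr1//; lra.
have {}p1 : 1 < p by rewrite lt_neqAle eq_sym pN1.
have p0 : 0 < p by lra.
have q0 : 0 < p / (p - 1) by rewrite divr_gt0//; lra.
have := @conjugate_powR R z 1 p (p / (p - 1)) z0 ler01 p0 q0.
rewrite invf_div powR1 mulr1 mul1r => /(_ _)/wrap[].
  by field; lra.
rewrite -(ler_pM2l p0) mulrDr !(mulrCA p) divff ?mulr1; lra.
Qed.

(** [powR_bernoulli] for the exponent 1/s at the point z^s. *)
Lemma powR_bernoulli_concave (R : realType) (s z : R) : 0 < s <= 1 -> 0 <= z ->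
  z `^ s <= 1 + s * (z - 1).
Proof.
move=> /andP[s0 s1] z0.
have : 1 + s^-1 * (z `^ s - 1) <= (z `^ s) `^ s^-1.
  by apply: powR_bernoulli; rewrite ?powR_ge0// invf_ge1.
rewrite -powRrM divff ?gt_eqF// powRr1//.
move=> H; suff : s * (1 + s^-1 * (z `^ s - 1)) <= s * z.
  by rewrite mulrDr mulrA divff ?gt_eqF//; lra.
by rewrite ler_pM2l.
Qed.

Lemma powR_tangent (R : realType) (p x y : R) : 1 <= p -> 0 <= x -> 0 <= y ->
  x `^ p + p * x `^ (p - 1) * (y - x) <= y `^ p.
Proof.
move=> p1 x0 y0; have p0 : 0 < p by lra.
rewrite -(mulr_powRB1 x0 p0).
(* At x = 0 the slope p * 0^(p-1) is 0 for p > 1, and 1 for p = 1. *)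
have [x_eq0|x_neq0] := eqVneq x 0.
  rewrite x_eq0 mul0r add0r subr0.
  have [->|pN1] := eqVneq p 1; first by rewrite subrr powRr0 !mul1r powRr1.
  by rewrite powR0 ?subr_eq0// mulr0 mul0r powR_ge0.
have xgt0 : 0 < x by rewrite lt_neqAle eq_sym x_neq0.
have yE : y = x * (y / x) by rewrite mulrCA divff// mulr1.
have yx0 : 0 <= y / x by rewrite divr_ge0.
rewrite yE; move: (y / x) yx0 => z z0.
rewrite powRM// -(mulr_powRB1 x0 p0).
have := powR_bernoulli _ _ _ p1 z0.
rewrite -(ler_pM2l (_ : 0 < x * x `^ (p - 1))); last by rewrite mulr_gt0 ?powR_gt0.
by apply: le_trans; rewrite le_eqVlt; apply/orP; left; apply/eqP; ring.
Qed.

(** At B = 1/A this is [powR_sub_inv_ge].  On the interval from 1/A to 1 the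
    function B^q - q B is nonincreasing, by the tangent line at B. *)
Lemma powR_sub_ge (R : realType) (q A B : R) : 1 <= q -> 0 < B -> B <= 1 ->
  1 <= A -> 1 <= A * B -> q * (A - B) <= A `^ q - B `^ q.
Proof.
move=> q1 B0 B1 A1 AB.
have A0 : 0 < A by lra.
have AVB : A^-1 <= B by rewrite -(ler_pM2l A0) divff ?gt_eqF.
have h1 := powR_sub_inv_ge _ _ _ q1 A1.
have : B `^ q + q * B `^ (q - 1) * (A^-1 - B) <= A^-1 `^ q.
  by apply: powR_tangent; rewrite ?invr_ge0//; exact: ltW.
have -> : A^-1 `^ q = A `^ (- q) by rewrite (powRVr _ _ _ (ltW A0)) powRN.
have : B `^ (q - 1) <= 1.
  rewrite -[X in _ <= X](powRr0 B); apply: ger_powR => //; last lra.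
  by rewrite B0.
move: h1; move: (A `^ q) (A `^ (- q)) (B `^ q) (B `^ (q - 1)) => a b c d h1.
move=> d1 ?.
have : 0 <= q * ((1 - d) * (B - A^-1)) by rewrite !mulr_ge0; lra.
nra.
Qed.

(** The power s - 1 is convex, so its mean over the interval from a to b is at
    least its value at the midpoint (Hermite-Hadamard).  After scaling the
    midpoint to 1 this is [powR_central_diff]; the singular case a = 0 reduces
    to s * 2^(1-s) <= 1. *)
Lemma powR_midpoint (R : realType) (s a b : R) : 0 < s < 1 -> 0 <= a < b ->
  s * (b - a) * ((a + b) / 2) `^ (s - 1) <= b `^ s - a `^ s.
Proof.
move=> /andP[s0 s1] /andP[a0 ab]; have b0 : 0 < b by lra.
have [->|aN0] := eqVneq a 0.
  rewrite powR0 ?gt_eqF// !subr0 add0r powRM//; last lra.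
  have -> : 2^-1 `^ (s - 1) = 2 `^ (1 - s) :> R.
    by rewrite powRVr// -powRN opprB.
  have : 2 `^ (1 - s) <= 1 + (1 - s) * (2 - 1) :> R.
    by apply: powR_bernoulli_concave; lra.
  rewrite -(mulr_powRB1 (ltW b0) s0).
  have : 0 < b `^ (s - 1) by rewrite powR_gt0.
  move: (_ `^ _) (2 `^ _) => c d c0 d1.
  have : 0 <= (b * c) * (1 - s * d).
    apply: mulr_ge0; [by apply: mulr_ge0; exact: ltW|rewrite subr_ge0].
    have : s * d <= s * (2 - s) by rewrite ler_pM2l//; lra.
    have := sqr_ge0 (s - 1); nra.
  nra.
have {aN0}a_gt0 : 0 < a by rewrite lt_neqAle eq_sym aN0.
set m := (a + b) / 2; have m0 : 0 < m by rewrite /m; lra.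
pose y := (b - a) / (2 * m).
have bE : b = m * (1 + y) by rewrite /y /m; field; lra.
have aE : a = m * (1 - y) by rewrite /y /m; field; lra.
have y0 : 0 <= y by rewrite divr_ge0; lra.
have y1 : y < 1 by rewrite ltr_pdivrMr; rewrite /m; lra.
clearbody y m; subst a b.
rewrite !powRM ?(ltW m0)//; [|lra|lra].
have := powR_central_diff _ s y; rewrite gt_eqF// y0 y1 => /(_ isT (ltW s1) isT).
rewrite ler_pdivlMr// -(mulr_powRB1 (ltW m0) s0) => H.
have : 0 < m * m `^ (s - 1) by rewrite mulr_gt0 ?powR_gt0.
nra.
Qed.

Lemma powR_second_diff (R : realType) (s x : R) : 0 < s < 1 -> 0 <= x <= 1 ->
  s * (1 - s) * x ^+ 2 <= 2 - (1 - x) `^ s - (1 + x) `^ s.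
Proof.
move=> s01 /andP[x0]; rewrite le_eqVlt => /orP[/eqP ->|x1]; last first.
  by apply: powR_second_diff_lt1 => //; rewrite x0 x1.
case/andP: s01 => s0 s1.
rewrite subrr powR0 ?gt_eqF// expr1n.
have : (1 + 1) `^ s <= 1 + s * ((1 + 1) - 1) :> R.
  by apply: powR_bernoulli_concave; lra.
nra.
Qed.

(** The supersolution inequality at x = 1/n, divided by n^(s(p-1)).  The bounds
    [Amid] and [Bmid] on the quotients A and B give A B >= (1 - x^2/4)^(s-1) >= 1,
    and [powR_second_diff] gives A - B >= (1 - s) x = x / p; then
    [powR_sub_ge] applies with q = p - 1. *)
Lemma hardy_weight_ge (R : realType) (p x : R) : 2 <= p -> 0 < x <= 1 ->
  ((p - 1) / p) `^ p * x `^ p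
    <= (1 - (1 - x) `^ ((p - 1) / p)) `^ (p - 1)
       - ((1 + x) `^ ((p - 1) / p) - 1) `^ (p - 1).
Proof.
move=> p2 /andP[x0 x1]; set s := (p - 1) / p.
have sp : s * p = p - 1 by rewrite /s; field; lra.
have s0 : 0 < s by rewrite divr_gt0; lra.
have s1 : s < 1 by rewrite ltr_pdivrMr; lra.
have sx0 : 0 < s * x by rewrite mulr_gt0.
pose A := (1 - (1 - x) `^ s) / (s * x).
pose B := ((1 + x) `^ s - 1) / (s * x).
have AE : 1 - (1 - x) `^ s = (s * x) * A by rewrite /A; field; lra.
have BE : (1 + x) `^ s - 1 = (s * x) * B by rewrite /B; field; lra.
have Amid : (1 - x / 2) `^ (s - 1) <= A.
  rewrite ler_pdivlMr//.
  have := powR_midpoint _ s (1 - x) 1; rewrite s0 s1 powR1 => /(_ isT)/(_ _)/wrap[].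
    by rewrite subr_ge0 x1 gtrBl.
  have -> : (1 - x + 1) / 2 = 1 - x / 2 by field.
  nra.
have Bmid : (1 + x / 2) `^ (s - 1) <= B.
  rewrite ler_pdivlMr//.
  have := powR_midpoint _ s 1 (1 + x); rewrite s0 s1 powR1 => /(_ isT)/(_ _)/wrap[].
    by rewrite ler01 ltrDl.
  have -> : (1 + (1 + x)) / 2 = 1 + x / 2 by field.
  nra.
have A1 : 1 <= A.
  rewrite ler_pdivlMr// mul1r.
  have : (1 - x) `^ s <= 1 + s * ((1 - x) - 1) by apply: powR_bernoulli_concave; lra.
  nra.
have B1 : B <= 1.
  rewrite ler_pdivrMr// mul1r.
  have : (1 + x) `^ s <= 1 + s * ((1 + x) - 1) by apply: powR_bernoulli_concave; lra.
  nra.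
have B0 : 0 < B by apply: lt_le_trans Bmid; rewrite powR_gt0; lra.
have AB : 1 <= A * B.
  apply: (@le_trans _ _ ((1 - x / 2) `^ (s - 1) * (1 + x / 2) `^ (s - 1))).
    rewrite -powRM; [|lra|lra].
    rewrite -[X in X <= _](powRr0 ((1 - x / 2) * (1 + x / 2))).
    apply: ger_powR; last lra.
    have := sqr_ge0 x; nra.
  by apply: ler_pM; rewrite ?powR_ge0.
have ABx : (1 - s) * x <= A - B.
  rewrite /A /B -mulrBl ler_pdivlMr//.
  have := powR_second_diff _ s x; rewrite s0 s1 x1 ltW// => /(_ isT isT); nra.
have key := powR_sub_ge _ (p - 1) A B.
rewrite AE BE !(powRM _ (ltW sx0)) ?(ltW B0)//; last lra.
rewrite -powRM; [|exact: ltW|exact: ltW]; rewrite -mulrBr -(mulr_powRB1 (ltW sx0)); last lra.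
rewrite mulrC ler_wpM2l ?powR_ge0//.
apply: le_trans (key _ _ _ _ _) => //; last lra.
have -> : s * x = (p - 1) * ((1 - s) * x) by rewrite mulrA; congr (_ * _); nra.
by rewrite ler_wpM2l//; lra.
Qed.

(** * Picone's inequality with a remainder *)

Lemma sqr_powR_half (R : realType) (p z : R) : (z ^+ 2) `^ (p / 2) = `|z| `^ p.
Proof.
rewrite -real_normK ?num_real// -powR_mulrn// -powRrM.
by congr (_ `^ _); field.
Qed.

Lemma normr_powR_tangent1 (R : realType) (p z : R) : 1 <= p ->
  1 + p * (z - 1) <= `|z| `^ p.
Proof.
move=> p1; apply: le_trans (powR_bernoulli _ p _ p1 (normr_ge0 z)).
by rewrite lerD2l ler_wpM2l ?lerD2r ?ler_norm//; lra.
Qed.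

Lemma c1_ge0 (R : realType) (p : R) : 2 <= p -> 0 <= c1 p.
Proof.
move=> p2; apply: lb_le_inf; first by have [] := has_inf_c1_values p2.
move=> _ [[s t] /= _ <-]; apply: divr_ge0; last exact: powR_ge0.
have : `|1 + s| `^ p <= (t ^+ 2 + s ^+ 2 + 2 * s + 1) `^ (p / 2).
  have := sqr_ge0 t; have := sqr_ge0 (1 + s) => ? ?.
  rewrite -sqr_powR_half; apply: ge0_ler_powR; rewrite ?nnegrE//; nra.
have := normr_powR_tangent1 R p (1 + s); lra.
Qed.

(** The infimum defining [c1 p], restricted to the axis t = 0. *)
Lemma c1_line (R : realType) (p s : R) : 2 <= p -> s != 0 ->
  1 + p * s + c1 p * `|s| `^ p <= `|1 + s| `^ p.
Proof.
move=> p2 s0.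
have : c1 p <= c1_quotient p s 0.
  apply: ge_inf; first by have [] := has_inf_c1_values p2.
  by exists (s, 0) => //= -[/eqP]; apply/negP.
rewrite /c1_quotient expr0n/= !add0r.
have -> : s ^+ 2 + 2 * s + 1 = (1 + s) ^+ 2 by ring.
rewrite !sqr_powR_half ler_pdivlMr ?powR_gt0 ?normr_gt0//; lra.
Qed.

(** The quotient at (s, t) = (-2, 0) equals 2 p / 2^p, which is at most 1. *)
Lemma c1_le1 (R : realType) (p : R) : 2 <= p -> c1 p <= 1.
Proof.
move=> p2.
have := c1_line R p (- 2) p2; rewrite oppr_eq0 pnatr_eq0 => /(_ isT).
have -> : `|1 + - 2| = 1 :> R by rewrite ler0_norm; lra.
rewrite powR1 normrN ger0_norm; last lra.
have : 2 * p <= 2 `^ p.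
  rewrite -(@mulr_powRB1 _ 2 p); [|lra|lra].
  have := powR_bernoulli R (p - 1) 2; move: (_ `^ _) => a; lra.
move: (2 `^ p) => a pa h.
have : (1 - c1 p) * a >= 0 by lra.
rewrite pmulr_lge0; lra.
Qed.

(** The left factor D is the increment of the supersolution, from b to D + b,
    and x, y are the values of v at the two ends, so that
    (D + b) x - b y = D x + b (x - y) is the increment of u.  Dividing by D x
    turns this into 1 + r, to which [c1_line] applies; the linear term p r is
    then traded for |x|^p - |y|^p by convexity. *)
Lemma picone_remainder (R : realType) (p D b x y : R) : 2 <= p ->
  0 < D -> 0 <= b ->
  D `^ (p - 1) * ((D + b) * `|x| `^ p - b * `|y| `^ p)
    + c1 p * (b `^ p * `|x - y| `^ p)
  <= `|(D + b) * x - b * y| `^ p.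
Proof.
move=> p2 D0 b0; have p0 : 0 < p by lra.
(* If x = 0 the right-hand side is (b |y|)^p, and c1(p) <= 1 is what is needed. *)
have [->|xN0] := eqVneq x 0.
  rewrite normr0 powR0 ?gt_eqF// !mulr0 !sub0r !normrN normrM (ger0_norm b0).
  rewrite powRM//.
  have : 0 <= D `^ (p - 1) * (b * `|y| `^ p) by rewrite !mulr_ge0 ?powR_ge0.
  have : 0 <= (1 - c1 p) * (b `^ p * `|y| `^ p).
    by rewrite !mulr_ge0 ?powR_ge0// subr_ge0 c1_le1.
  lra.
pose r := b * (x - y) / (D * x).
have Dx0 : D * x != 0 by rewrite mulf_neq0// gt_eqF.
have -> : (D + b) * x - b * y = (D * x) * (1 + r).
  by rewrite /r; field; rewrite xN0 gt_eqF.
have -> : b `^ p * `|x - y| `^ p = `|D * x| `^ p * `|r| `^ p.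
  rewrite -[in RHS]powRM// -normrM.
  have -> : D * x * r = b * (x - y) by rewrite /r mulrCA divff// mulr1.
  by rewrite normrM (ger0_norm b0) powRM.
have -> : D `^ (p - 1) * ((D + b) * `|x| `^ p - b * `|y| `^ p) =
    `|D * x| `^ p * (1 + b / D * (1 - `|y / x| `^ p)).
  rewrite [X in _ = X `^ _ * _]normrM [in RHS]powRM// (gtr0_norm D0) -(mulr_powRB1 (ltW D0) p0).
  have -> : `|y| `^ p = `|x| `^ p * `|y / x| `^ p.
    by rewrite -powRM// -normrM mulrCA divff// mulr1.
  by field; rewrite gt_eqF.
rewrite (normrM _ (1 + r)) (powRM _ (normr_ge0 (D * x)) (normr_ge0 (1 + r))) [c1 p * _]mulrCA -mulrDr.
apply: ler_wpM2l; first exact: powR_ge0.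
have tan : b / D * (1 - `|y / x| `^ p) <= p * r.
  have -> : p * r = b / D * (p * (1 - y / x)).
    by rewrite /r; field; rewrite xN0 gt_eqF.
  apply: ler_wpM2l; first by rewrite divr_ge0// ltW.
  have := normr_powR_tangent1 R p (y / x); lra.
have [r0|rN0] := eqVneq r 0.
  by move: tan; rewrite r0 normr0 powR0 ?gt_eqF// !mulr0 !addr0 normr1 powR1; lra.
have := c1_line R p r p2 rN0; lra.
Qed.

(** * Two summed Hardy inequalities *)

(** Summation by parts of [picone_remainder].  The second term on the left is
    the boundary term: carrying it along makes the induction step exactly the
    supersolution hypothesis. *)
Lemma ground_state_ineq (R : realType) (p : R) (h w v : nat -> R) (N : nat) :
  2 <= p -> h 0%N = 0 -> (forall n, 0 <= h n) -> (forall n, h n < h n.+1) ->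
  (forall n, w n.+1 * h n.+1 `^ (p - 1)
     <= (h n.+1 - h n) `^ (p - 1) - (h n.+2 - h n.+1) `^ (p - 1)) ->
  \sum_(1 <= n < N.+1) (w n * `|h n * v n| `^ p
      + c1 p * (h n.-1 `^ p * `|v n - v n.-1| `^ p))
    + (h N.+1 - h N) `^ (p - 1) * (h N * `|v N| `^ p)
  <= \sum_(1 <= n < N.+1) `|h n * v n - h n.-1 * v n.-1| `^ p.
Proof.
move=> p2 h0 hge0 hlt hw; have p0 : 0 < p by lra.
elim: N => [|N IH]; first by rewrite !big_geq// h0 mul0r mulr0 addr0.
rewrite !(big_nat_recr N.+1)//=.
have D0 : 0 < h N.+1 - h N by rewrite subr_gt0.
have := picone_remainder R p _ _ (v N.+1) (v N) p2 D0 (hge0 N).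
rewrite subrK.
have : w N.+1 * `|h N.+1 * v N.+1| `^ p
    <= ((h N.+1 - h N) `^ (p - 1) - (h N.+2 - h N.+1) `^ (p - 1))
       * (h N.+1 * `|v N.+1| `^ p).
  rewrite normrM (ger0_norm (hge0 _)) powRM// -(mulr_powRB1 (hge0 N.+1) p0).
  have := ler_wpM2r (mulr_ge0 (hge0 N.+1) (powR_ge0 `|v N.+1| p)) (hw N).
  by apply: le_trans; rewrite le_eqVlt; apply/orP; left; apply/eqP; ring.
lra.
Qed.

(** One summand of Elliott's proof of Hardy's inequality with weights: x' and x
    are two consecutive values of the averages A(n) / L(n), and the terms in
    L x^p and L' x'^p telescope.  Two tangent inequalities at x suffice, one
    evaluated at q a and one at x'. *)
Lemma weighted_hardy_step (R : realType) (p l a L L' x x' : R) : 1 < p -> 0 < l ->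
  0 <= a -> 0 <= L' -> L = L' + l -> 0 <= x -> 0 <= x' ->
  L * x <= L' * x' + l * a ->
  l * x `^ p + p / (p - 1) * (L * x `^ p)
    <= (p / (p - 1)) `^ p * (l * a `^ p) + p / (p - 1) * (L' * x' `^ p).
Proof.
move=> p1 l0 a0 L'0 -> x0 x'0 Lx; set q := p / (p - 1).
have pq : p * q = p + q by rewrite /q; field; lra.
have q0 : 0 < q by rewrite divr_gt0; lra.
have p0 : 0 < p by lra.
have xE := mulr_powRB1 x0 p0.
have tan1 : x `^ p + p * x `^ (p - 1) * (q * a - x) <= q `^ p * a `^ p.
  rewrite -powRM ?(ltW q0)//; apply: powR_tangent => //; first lra.
  by rewrite mulr_ge0// ltW.
have tan2 : x `^ p + p * x `^ (p - 1) * (x' - x) <= x' `^ p.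
  by apply: powR_tangent => //; lra.
have y0 := powR_ge0 x (p - 1).
move: (x `^ (p - 1)) (x `^ p) (a `^ p) (x' `^ p) (q `^ p) xE tan1 tan2 y0.
move=> y X A X' Q <- tan1 tan2 y0.
have {}tan1 := ler_wpM2l (ltW l0) tan1.
have {}tan2 := ler_wpM2l (mulr_ge0 (ltW q0) L'0) tan2.
have {}Lx := ler_wpM2l (mulr_ge0 (ltW (mulr_gt0 p0 q0)) y0) Lx.
(* The differences on the right are those of [tan1], [tan2] and [Lx]; the last
   term vanishes because p q = p + q. *)
have -> : l * (x * y) + q * ((L' + l) * (x * y)) =
  l * (x * y + p * y * (q * a - x)) + q * L' * (x * y + p * y * (x' - x))
  + (p * q * y * ((L' + l) * x) - p * q * y * (L' * x' + l * a))
  + (p + q - p * q) * (l * (x * y)).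
  ring.
rewrite -pq subrr mul0r addr0.
lra.
Qed.

(** Hardy's inequality with weights l, applied to the differences of g; the
    averages of |g(n+1) - g(n)| / l(n) dominate |g(n)| / L(n) by the triangle
    inequality, because g vanishes at 0. *)
Lemma weighted_hardy (R : realType) (p : R) (l g : nat -> R) (N : nat) :
  1 < p -> (forall n, 0 < l n) -> g 0%N = 0 ->
  \sum_(0 <= n < N) l n * (`|g n.+1| / \sum_(0 <= k < n.+1) l k) `^ p
   <= (p / (p - 1)) `^ p * \sum_(0 <= n < N) l n * (`|g n.+1 - g n| / l n) `^ p.
Proof.
move=> p1 l0 g0; set q := p / (p - 1); pose L n := \sum_(0 <= k < n) l k.
have LS n : L n.+1 = L n + l n by rewrite /L big_nat_recr.
have L0 n : 0 <= L n by rewrite /L sumr_ge0// => k _; exact: ltW.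
have LS0 n : 0 < L n.+1 by rewrite LS ltr_wpDl.
have q0 : 0 < q by rewrite divr_gt0; lra.
pose x n := `|g n| / L n.
have x0 n : 0 <= x n by rewrite divr_ge0.
have Lx n : L n * x n = `|g n|.
  case: n => [|n]; first by rewrite /L big_geq// mul0r g0 normr0.
  by rewrite /x mulrCA divff ?mulr1// gt_eqF.
suff : \sum_(0 <= n < N) l n * x n.+1 `^ p + q * (L N * x N `^ p)
   <= q `^ p * \sum_(0 <= n < N) l n * (`|g n.+1 - g n| / l n) `^ p.
  apply: le_trans; rewrite lerDl; apply: mulr_ge0; first exact: ltW.
  by apply: mulr_ge0 => //; exact: powR_ge0.
elim: N => [|N IH].
  by rewrite !big_geq// {1}/L big_geq// mul0r !mulr0 addr0.
rewrite !(big_nat_recr N)//= mulrDr.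
have := @weighted_hardy_step R p (l N) (`|g N.+1 - g N| / l N) (L N.+1) (L N)
  (x N.+1) (x N) p1 (l0 N).
rewrite divr_ge0 ?(ltW (l0 N))// !Lx => /(_ isT (L0 N) (LS N) (x0 _) (x0 _)).
move=> /(_ _)/wrap[].
  rewrite mulrCA divff ?gt_eqF// mulr1.
  by have := ler_normD (g N.+1 - g N) (g N); rewrite subrK; lra.
rewrite -/q; lra.
Qed.

(** Each step uses 1/(n+2) <= - ln (1 - 1/(n+2)) = ln (n+2) - ln (n+1). *)
Lemma sum_inv_le_ln (R : realType) (n : nat) :
  \sum_(0 <= k < n) (k.+2)%:R^-1 <= ln (n.+1)%:R :> R.
Proof.
elim: n => [|n IH]; first by rewrite big_geq// ln1.
rewrite big_nat_recr//=.
have n1 : 0 < (n.+1)%:R :> R by rewrite ltr0n.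
have n2 : 0 < (n.+2)%:R :> R by rewrite ltr0n.
have : ln (1 + - (n.+2)%:R^-1) <= - (n.+2)%:R^-1 :> R.
  by apply: le_ln1Dx; rewrite ltrN2 invf_lt1// ltr1n.
have -> : 1 + - (n.+2)%:R^-1 = (n.+1)%:R / (n.+2)%:R :> R.
  rewrite -[in RHS](_ : (n.+2)%:R - 1 = n.+1%:R); last by rewrite -natr1 addrK.
  by rewrite mulrBl divff ?gt_eqF// mul1r.
rewrite ln_div ?posrE//.
by rewrite lerBlDl -lerBrDr; exact: le_trans.
Qed.

(** * The inequality for partial sums *)

(** The sequence h is homogeneous, so the factor h(n+1)^(p-1) splits off and
    [hardy_weight_ge] remains, at x = 1/(n+1). *)
Lemma ground_state_supersolution (R : realType) (p : R) (n : nat) : 2 <= p ->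
  let s : R := (p - 1) / p in
  let h k : R := k%:R `^ s in
  (s `^ p / (n.+1)%:R `^ p * h n.+1 `^ (p - 1)
     <= (h n.+1 - h n) `^ (p - 1) - (h n.+2 - h n.+1) `^ (p - 1))%R.
Proof.
move=> p2 /=; set s := (p - 1) / p; pose h k : R := k%:R `^ s.
rewrite -/(h n) -/(h n.+1) -/(h n.+2).
have s0 : 0 < s by rewrite divr_gt0; lra.
have m0 : 0 < (n.+1)%:R :> R by rewrite ltr0n.
pose x : R := (n.+1)%:R^-1.
have x0 : 0 < x by rewrite invr_gt0.
have x1 : x <= 1 by rewrite invf_le1// ler1n.
have h0 : 0 <= h n.+1 by exact: powR_ge0.
have mx : (n.+1)%:R * x = 1 by rewrite divff// gt_eqF.
have hn : h n = h n.+1 * (1 - x) `^ s.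
  rewrite /h -powRM ?(ltW m0) ?subr_ge0// mulrBr mx mulr1.
  by rewrite -[in RHS]natr1 addrK.
have hn2 : h n.+2 = h n.+1 * (1 + x) `^ s.
  by rewrite /h -powRM ?addr_ge0 ?(ltW m0) ?(ltW x0)// mulrDr mx mulr1 natr1.
have hw := hardy_weight_ge R p x p2; rewrite x0 x1 -/s in hw.
have -> : h n.+1 - h n = h n.+1 * (1 - (1 - x) `^ s).
  by rewrite hn mulrBr mulr1.
have -> : h n.+2 - h n.+1 = h n.+1 * ((1 + x) `^ s - 1).
  by rewrite hn2 mulrBr mulr1.
have le1 : 0 <= 1 - (1 - x) `^ s.
  rewrite subr_ge0 -[leRHS](congr1 (@^~ s) (powR1 R)).
  by apply: ge0_ler_powR; rewrite ?nnegrE//; lra.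
have le2 : 0 <= (1 + x) `^ s - 1.
  rewrite subr_ge0 -[leLHS](congr1 (@^~ s) (powR1 R)).
  by apply: ge0_ler_powR; rewrite ?nnegrE//; lra.
rewrite (powRM _ h0 le1) (powRM _ h0 le2) -mulrBr [leLHS]mulrC.
apply: ler_wpM2l; first exact: powR_ge0.
apply: le_trans (hw isT).
by rewrite /x (powRVr _ p _ (ltW m0)).
Qed.

(** The constant s^p compensates the constant (p / (p-1))^p of [weighted_hardy],
    so only the factor c1(p) of [ground_state_ineq] survives. *)
Lemma hardy_remainder_partial (R : realType) (p : R) (u : nat -> R) (N : nat) :
  2 <= p -> u 0%N = 0 ->
  let s : R := (p - 1) / p in
  let c : R := u 2 / 2 `^ s in
  (c1 p * s `^ p * (\sum_(3 <= n < N.+3)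
     `|u n - c * n%:R `^ s| `^ p / (n%:R `^ p * ln n%:R `^ p))
  <= \sum_(1 <= n < N.+3) `|u n - u n.-1| `^ p
     - s `^ p * (\sum_(1 <= n < N.+3) `|u n| `^ p / n%:R `^ p))%R.
Proof.
move=> p2 u0 /=; set s := (p - 1) / p; set c := u 2%N / 2 `^ s.
have p0 : 0 < p by lra.
have s0 : 0 < s by rewrite divr_gt0; lra.
have sp : s * p = p - 1 by rewrite /s; field; lra.
pose h n : R := n%:R `^ s.
pose v n := u n / h n.
have h0 : h 0%N = 0 by rewrite /h powR0 ?gt_eqF.
have hge0 n : 0 <= h n by exact: powR_ge0.
have hgt0 n : 0 < h n.+1 by rewrite powR_gt0 ?ltr0n.
have hlt n : h n < h n.+1.
  by rewrite /h; apply: gt0_ltr_powR; rewrite ?nnegrE ?ler0n// ltr_nat.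
have uE n : u n = h n * v n.
  case: n => [|n]; first by rewrite u0 h0 mul0r.
  by rewrite /v mulrCA divff ?mulr1// gt_eqF.
have hp n : h n `^ p = n%:R `^ (p - 1) by rewrite /h -powRrM sp.
have c1p := c1_ge0 R p p2.
pose E n := h n.-1 `^ p * `|v n - v n.-1| `^ p.
have E0 n : 0 <= E n by rewrite mulr_ge0 ?powR_ge0.
have := @ground_state_ineq R p h (fun n => s `^ p / n%:R `^ p) v N.+2 p2 h0 hge0 hlt
  (fun n => @ground_state_supersolution R p n p2).
rewrite big_split/= => H.
have {H} : s `^ p * (\sum_(1 <= n < N.+3) `|u n| `^ p / n%:R `^ p)
   + c1 p * (\sum_(1 <= n < N.+3) E n)
   <= \sum_(1 <= n < N.+3) `|u n - u n.-1| `^ p.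
  have -> : \sum_(1 <= n < N.+3) `|u n - u n.-1| `^ p
     = \sum_(1 <= n < N.+3) `|h n * v n - h n.-1 * v n.-1| `^ p.
    by apply: eq_bigr => n _; rewrite -!uE.
  apply: le_trans H; rewrite !mulr_sumr; apply: ler_wpDr.
    by rewrite !mulr_ge0 ?powR_ge0.
  rewrite lerD2r le_eqVlt; apply/orP; left; apply/eqP.
  by apply: eq_bigr => n _; rewrite -uE mulrA mulrAC.
have split3 : \sum_(3 <= n < N.+3) E n <= \sum_(1 <= n < N.+3) E n.
  rewrite [leRHS](@big_cat_nat _ _ _ 3)//= lerDr.
  by apply: sumr_ge0.
(* Index k of the second inequality corresponds to n = k + 3: the weight l k is
   1/(n-1), and g vanishes at the starting point n = 2. *)
pose l k : R := (k.+2)%:R^-1.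
pose g k := v k.+2 - v 2%N.
have l0 k : 0 < l k by rewrite invr_gt0 ltr0n.
have g0 : g 0%N = 0 by rewrite /g subrr.
have p1 : 1 < p by lra.
have WH := weighted_hardy R p l g N p1 l0 g0.
have le_lhs : \sum_(3 <= n < N.+3)
     `|u n - c * n%:R `^ s| `^ p / (n%:R `^ p * ln n%:R `^ p)
  <= \sum_(0 <= n < N) l n * (`|g n.+1| / \sum_(0 <= k < n.+1) l k) `^ p.
  rewrite -[3%N in leLHS]add0n big_addn -addn3 addnK; apply: ler_sum => k _.
  rewrite addn3.
  have m0 : 0 < (k.+3)%:R :> R by rewrite ltr0n.
  have gE : u k.+3 - c * (k.+3)%:R `^ s = h k.+3 * g k.+1.
    by rewrite uE /g /c -/(h 2%N) -/(v 2%N) -/(h k.+3); ring.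
  have L0 : 0 < \sum_(0 <= j < k.+1) l j.
    by rewrite big_nat_recr//= ltr_wpDl// sumr_ge0// => j _; exact: ltW.
  have Lln : \sum_(0 <= j < k.+1) l j <= ln (k.+3)%:R.
    apply: (le_trans (sum_inv_le_ln R k.+1)).
    by rewrite ler_ln ?posrE ?ltr0n// ler_nat.
  rewrite gE normrM (ger0_norm (hge0 _)) powRM// hp.
  have -> : (k.+3)%:R `^ p = (k.+3)%:R * (k.+3)%:R `^ (p - 1) :> R.
    by rewrite mulr_powRB1// ltW.
  rewrite powRM ?invr_ge0 ?(ltW L0)// (powRVr _ p _ (ltW L0)).
  have m1 : 0 < (k.+3)%:R `^ (p - 1) :> R by rewrite powR_gt0.
  (* The weight n^p below contributes 1/n after the factor n^(p-1) = h(n)^p of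
     |u(n) - c h(n)|^p has been cancelled. *)
  have cancelM (G M a b : R) : 0 < M -> M * G / (a * M * b) = a^-1 * (G * b^-1).
    move=> M0; rewrite !invfM.
    transitivity ((M / M) * (a^-1 * (G * b^-1))); first by ring.
    by rewrite divff ?mul1r// gt_eqF.
  rewrite cancelM//; apply: ler_pM; rewrite ?invr_ge0 ?mulr_ge0 ?invr_ge0 ?powR_ge0//.
    by rewrite /l lef_pV2 ?posrE ?ltr0n// ler_nat.
  apply: ler_wpM2l; first exact: powR_ge0.
  rewrite lef_pV2 ?posrE ?powR_gt0//; last exact: lt_le_trans L0 Lln.
  apply: ge0_ler_powR; rewrite ?nnegrE ?(ltW p0) ?(ltW L0)//.
  exact: le_trans (ltW L0) Lln.
have rhsE : \sum_(0 <= n < N) l n * (`|g n.+1 - g n| / l n) `^ p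
   = \sum_(3 <= n < N.+3) E n.
  rewrite -[3%N in RHS]add0n big_addn -addn3 addnK; apply: eq_bigr => k _.
  rewrite addn3 /E/= hp.
  have -> : g k.+1 - g k = v k.+3 - v k.+2 by rewrite /g; ring.
  rewrite /l invrK powRM// [_ * _ `^ p]mulrC mulrA; congr (_ * _).
  rewrite -(mulr_powRB1 _ p0)// mulrA mulVf ?mul1r//.
rewrite rhsE in WH.
have sq : s `^ p * (p / (p - 1)) `^ p = 1.
  rewrite -powRM ?(ltW s0)//; last by rewrite divr_ge0; lra.
  rewrite (_ : s * _ = 1) ?powR1// /s; field; lra.
have := ler_wpM2l (mulr_ge0 c1p (powR_ge0 s p)) (le_trans le_lhs WH).
rewrite -[leRHS]mulrA [s `^ p * ((_ / _) `^ p * _)]mulrA sq mul1r.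
have := ler_wpM2l c1p split3.
lra.
Qed.

(** * Passage to the series *)

Local Open Scope ereal_scope.

Lemma finitely_supported_eventually0 (R : realType) (u : nat -> R) :
  finitely_supported u -> exists M, forall n, (M <= n)%N -> u n = 0%R.
Proof.
move=> /finite_seqP[s us]; exists (\max_(i <- s) i).+1 => n Mn.
apply/eqP; apply: contraTT Mn => un0.
have : [set n | u n != 0%R] n by [].
rewrite us /= => ns.
by rewrite -leqNgt (@leq_bigmax_seq _ s xpredT id).
Qed.

Lemma nneseries_eventually0 (R : realType) (f : nat -> R) (m K : nat) :
  (m <= K)%N -> (forall n, (0 <= f n)%R) ->
  (forall n, (K <= n)%N -> f n = 0%R) ->
  \sum_(m <= n <oo) (f n)%:E = (\sum_(m <= n < K) f n)%R%:E.
Proof.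
move=> mK f0 fK; rewrite (@nneseries_split _ _ m (K - m)) => [|k _]; last first.
  by rewrite lee_fin.
rewrite subnKC// eseries0 ?adde0 ?sumEFin// => i Ki _.
by rewrite fK.
Qed.

Lemma nneseries_le (R : realType) (f : nat -> R) (m : nat) (x : \bar R) :
  (forall n, (0 <= f n)%R) ->
  (forall N, (\sum_(m <= n < N + m) f n)%R%:E <= x) ->
  \sum_(m <= n <oo) (f n)%:E <= x.
Proof.
move=> f0 fx; apply: lime_le.
  by apply: is_cvg_nneseries => n _ _; rewrite lee_fin.
near=> N.
have mN : (m <= N)%N by near: N; exact: nbhs_infty_ge.
by rewrite sumEFin -(subnK mN).
Unshelve. all: by end_near. Qed.

Theorem theorem3p7 (R : realType) (p : R) (hp : (2 <= p)%R)
    (u : nat -> R) (hu : finitely_supported u) (hu0 : u 0%N = 0%R) :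
  \sum_(1 <= n <oo) (`|u n - u n.-1| `^ p)%:E
    - (((p - 1) / p) `^ p)%:E
      * \sum_(1 <= n <oo) (`|u n| `^ p / n%:R `^ p)%:E
  >= (c1 p)%:E * (((p - 1) / p) `^ p)%:E
      * ereal_inf [set \sum_(3 <= n <oo)
          (`|u n - c * n%:R `^ ((p - 1) / p)| `^ p
             / (n%:R `^ p * ln n%:R `^ p))%:E | c in [set: R]].
Proof.
have p0 : p != 0%R by rewrite gt_eqF// (lt_le_trans _ hp).
have [M uM] := finitely_supported_eventually0 R u hu.
set s := ((p - 1) / p)%R; pose c := (u 2 / 2 `^ s)%R.
have k0 : (0 <= c1 p * s `^ p)%R by rewrite mulr_ge0 ?powR_ge0 ?c1_ge0.
pose F n := (`|u n - c * n%:R `^ s| `^ p / (n%:R `^ p * ln n%:R `^ p))%R.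
have F0 n : (0 <= F n)%R by rewrite divr_ge0 ?mulr_ge0 ?powR_ge0.
apply: (@le_trans _ _ ((c1 p * s `^ p)%:E * \sum_(3 <= n <oo) (F n)%:E)).
  rewrite -EFinM; apply: lee_wpmul2l; first by rewrite lee_fin.
  by apply: ereal_inf_lbound; exists c.
have du0 n : (M.+1 <= n)%N -> (`|u n - u n.-1| `^ p = 0)%R.
  by case: n => // n Mn; rewrite (uM n.+1 (ltnW Mn)) (uM n Mn) subrr normr0 powR0.
have du_ge0 n : (0 <= `|u n - u n.-1| `^ p)%R by exact: powR_ge0.
have hu_0 n : (M.+1 <= n)%N -> (`|u n| `^ p / n%:R `^ p = 0)%R.
  by move=> Mn; rewrite uM ?(ltnW Mn)// normr0 powR0// mul0r.
have hu_ge0 n : (0 <= `|u n| `^ p / n%:R `^ p)%R by rewrite divr_ge0 ?powR_ge0.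
rewrite (nneseries_eventually0 R _ 1 M.+1 isT du_ge0 du0).
rewrite (nneseries_eventually0 R _ 1 M.+1 isT hu_ge0 hu_0).
rewrite -nneseriesZl => [|n _]; last by rewrite lee_fin.
under eq_eseriesr do rewrite -EFinM.
rewrite -EFinM -EFinB.
apply: nneseries_le => [n|N]; first by rewrite mulr_ge0.
rewrite -big_distrr/= lee_fin.
(* Both finite sums on the right may be extended up to the length N + M + 3 at
   which the inequality for partial sums is applied. *)
have fin_eq (f : nat -> R) K : (forall n, (0 <= f n)%R) ->
    (forall n, (M.+1 <= n)%N -> f n = 0%R) -> (M.+1 <= K)%N ->
    (\sum_(1 <= n < M.+1) f n = \sum_(1 <= n < K) f n)%R.
  move=> f0 fM MK; apply: EFin_inj.
  rewrite -(nneseries_eventually0 R f 1 M.+1)//.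
  rewrite -(nneseries_eventually0 R f 1 K)// => [|n /(leq_trans MK)/fM//].
  exact: leq_trans MK.
have MK : (M.+1 <= (N + M).+3)%N by rewrite !ltnS ltnW// ltnW// ltnS ltnS leq_addl.
rewrite (fin_eq _ _ du_ge0 du0 MK) (fin_eq _ _ hu_ge0 hu_0 MK).
apply: le_trans (hardy_remainder_partial R p u (N + M) hp hu0).
apply: ler_wpM2l => //.
rewrite addn3 (@big_cat_nat _ _ _ N.+3 3 (N + M).+3)//=.
  by rewrite lerDl; apply: sumr_ge0 => n _; exact: F0.
by rewrite !ltnS leq_addr.
Qed.
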